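(* There exists $M\in\mathbb{N}$ such that for all integers $m\ge M$ the sequence $\{u_i(m)\}_{2\le i\le m-2}$ is strictly log-concave, i.e. $$u_i(m)^2>u_{i-1}(m)\,u_{i+1}(m)\qquad\text{for all integers } i \text{ with } 3\le i\le m-3.$$
   Context: For integers $0\le i\le m$, the Boros–Moll numbers are $$d_i(m)=2^{-2m}\sum_{k=i}^m 2^k\binom{2m-2k}{m-k}\binom{m+k}{k}\binom{k}{i},$$ and for $1\le i\le m-1$, $$u_i(m)=\frac{d_{i-1}(m)\,d_{i+1}(m)}{d_i(m)^2}.$$ *)

(* Defs.v *)
From mathcomp Require Import all_boot all_order all_algebra.

Set Implicit Arguments.
Unset Strict Implicit.
Unset Printing Implicit Defensive.

Import Order.TTheory GRing.Theory Num.Theory.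
Local Open Scope ring_scope.

(* Boros-Moll numbers d_i(m), meaningful for i <= m. *)
Definition boros_moll (m i : nat) : rat :=
  2 ^- (2 * m) *
  \sum_(i <= k < m.+1)
     2 ^+ k * 'C(2 * m - 2 * k, m - k)%:R * 'C(m + k, k)%:R * 'C(k, i)%:R.

(* The ratios u_i(m), meaningful for 1 <= i <= m - 1, where the predecessor
   i.-1 is not truncated and the denominator is nonzero. *)
Definition boros_moll_ratio (m i : nat) : rat :=
  boros_moll m i.-1 * boros_moll m i.+1 / boros_moll m i ^+ 2.

(* Main.v *)
Require Import Defs.
From Stdlib Require Import BinNat BinInt BinList Ring_polynom.
From mathcomp Require Import all_boot all_order all_algebra.
From mathcomp Require Import ssrZ zify ring common.

Set Implicit Arguments.
Unset Strict Implicit.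
Unset Printing Implicit Defensive.

Import Order.TTheory GRing.Theory Num.Theory.
Local Open Scope ring_scope.

(** The inequality holds for every [m], so [M = 0] serves.

    Write [e_j = j! d_j(m)], the [j]-th derivative at 0 of the Boros-Moll
    polynomial of degree [m].  The differential equation of that polynomial
    becomes a three-term recurrence ([bm_deriv_rec]),
      [e_(j+2) = (2m+1) e_(j+1) - (m-j)(m+j+1) e_j],
    so the five numbers [d_(i-2), ..., d_(i+2)] in the inequality, which reads
    [d_(i-2) d_i^6 d_(i+2) < d_(i-1)^4 d_(i+1)^4], are all determined, up to a
    common factor, by the single ratio [e_i / e_(i-1)].  It remains to locate
    this ratio well enough, and then to check a polynomial inequality.

    The ratio has a continued fraction with positive terms,
      [e_(j+1)/e_j = (m-j) - y_1],       [y_1 = (m-j) / (2j+3+y_2)],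
      [y_2 = 3(m-j-1) / (2j+6+y_3)],     [y_3 = 5(m-j-2) / (2j+9+y_4)], ...
    found by substituting each line into the Riccati equation of the previous
    tail: every tail satisfies an equation of the same shape, namely
      [y_k(j-1) (m+j+2k-1+y_k(j)) = (m-j+2-k) (2k-1+y_k(j))],
    which propagates positivity from [j] down to [j-1].  Cleared of
    denominators, the tails are [y_1 = gap1/e], [y_2 = gap2/gap1],
    [y_3 = gap3/gap2], and the Riccati equations turn into the linear relations
      [(m+j+1) gap_k(j) = gap_k(j+1) + (2k-1) gap_(k-1)(j+1)]
    ([gap1_back], [gap2_back], [gap3_back]).  A descending induction from
    [j = m], where all the gaps vanish, shows that they are nonnegative.

    Knowing that [y_3 >= 0] is enough.  With [h = i-1], all the [e]'s involved
    are linear in [u = gap2(h)] and [v = gap3(h)], and the inequality to prove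
    becomes polynomial in [h], [m-h], [u], [v].  After the shift to the
    variables [h-2] and [m-h-4], which are nonnegative exactly on the range
    [3 <= i <= m-3], all its coefficients are nonnegative
    ([quartic_expr_coefs]), which the kernel checks by computing the normal
    form of the polynomial. *)

(** * Positivity of polynomials with nonnegative coefficients *)

Definition eval_expr (R : realDomainType) : seq R -> PExpr Z -> R :=
  PEeval 0 1 +%R *%R (fun x y => x - y) -%R
    (fun n => (int_of_Z n)%:~R) id (fun x n => x ^+ N.to_nat n).

Definition eval_pol (R : realDomainType) : seq R -> Pol Z -> R :=
  Pphi 0 +%R *%R (fun n => (int_of_Z n)%:~R).

Definition normal_form : PExpr Z -> Pol Z :=
  norm_aux Z0 (Zpos xH) Z.add Z.mul Z.sub Z.opp Z.eqb.

Fixpoint nonneg_coefs (p : Pol Z) : bool :=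
  match p with
  | Pc c => Z.leb Z0 c
  | Pinj _ q => nonneg_coefs q
  | PX q _ r => nonneg_coefs q && nonneg_coefs r
  end.

Lemma eval_normal_form (R : realDomainType) (l : seq R) e :
  eval_expr l e = eval_pol l (normal_form e).
Proof.
exact: (norm_aux_spec (Eqsth R) (Eq_ext _ _ _)
  (Rth_ARth (Eqsth R) (Eq_ext _ _ _) (RR R)) (RZ R) (PN R)).
Qed.

Lemma all_jump (T : Type) (a : pred T) j l : all a l -> all a (jump j l).
Proof.
have all_tl s : all a s -> all a (List.tl s) by case: s => //= x s /andP[].
elim: j l => [j IH|j IH|] l al /=.
- exact/IH/IH/all_tl.
- exact/IH/IH.
- exact: all_tl.
Qed.

Lemma eval_pol_ge0 (R : realDomainType) p (l : seq R) :
  all (>= 0) l -> nonneg_coefs p -> 0 <= eval_pol l p.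
Proof.
elim: p l => [c|j q IH|q IHq j r IHr] l l_ge0 /=.
- by rewrite ler0z; case: c.
- by apply: IH; apply: all_jump.
- case/andP=> q_ge0 r_ge0; apply: addr_ge0; last first.
    by apply: IHr => //; case: l l_ge0 => //= x l /andP[].
  apply: mulr_ge0; first exact: IHq.
  have x_ge0: 0 <= List.hd 0 l by case: l l_ge0 => //= x l /andP[].
  by elim: j => //= j IH; rewrite ?mulr_ge0.
Qed.

Lemma expr_ge0 (R : realDomainType) (l : seq R) e :
  all (>= 0) l -> nonneg_coefs (normal_form e) -> 0 <= eval_expr l e.
Proof. by rewrite eval_normal_form; apply: eval_pol_ge0. Qed.

(** * The polynomial inequality *)

Declare Scope pexpr_scope.
Delimit Scope pexpr_scope with pe.
Notation "x + y" := (PEadd x y) : pexpr_scope.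
Notation "x - y" := (PEsub x y) : pexpr_scope.
Notation "x * y" := (PEmul x y) : pexpr_scope.
Notation "x ^+ n" := (PEpow x n%num) : pexpr_scope.
Notation "n %:C" := (PEc (Z.of_nat n))
  (at level 2, left associativity, format "n %:C") : pexpr_scope.

(** The difference of the two sides of [quartic_gap], in terms of the variables
    [h - 2], [n - 4], [u], [v].  The subtracted [u ^+ 8] is at most the leading
    term in [u] and makes the resulting inequality strict. *)
Definition quartic_expr : PExpr Z :=
  (let a := PEX Z 1 in let b := PEX Z 2 in
   let u := PEX Z 3 in let v := PEX Z 4 in
   let h := a + 2%:C in let n := b + 4%:C in
   let T := 2%:C * (h + n) + 1%:C in
   let w := (2%:C * h + 6%:C) * u + v in
   let x0 := 3%:C * (n - 1%:C) * u + (2%:C * h + 3%:C) * w in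
   let x1 := n * (x0 - w) in
   let x2 := T * x1 - n * (2%:C * h + n + 1%:C) * x0 in
   let x3 := T * x2 - (n - 1%:C) * (2%:C * h + n + 2%:C) * x1 in
   (h + 1%:C) ^+ 3 * (h + 3%:C) * ((n + 1%:C) * (2%:C * h + n))
     * x0 ^+ 4 * x2 ^+ 4
   - (h * (h + 2%:C) ^+ 3 * (T * x0 - x1) * x1 ^+ 6 * x3 + u ^+ 8))%pe.

Lemma quartic_expr_coefs : nonneg_coefs (normal_form quartic_expr).
Proof. by vm_compute. Qed.

(** Here [h = i-1], [n = m-h], [T = 2m+1], and [x0, x1, x2, x3] are common
    multiples of [e_h, ..., e_(h+3)]: the equations for [w], [x0], [x1] unfold
    the continued fraction of [e_(h+1)/e_h] down to its third tail [v/u], those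
    for [x2], [x3] are the three-term recurrence.  By the same recurrence
    [T * x0 - x1] is a multiple of [e_(h-1)]. *)
Lemma quartic_gap (R : realDomainType) (h n u v T w x0 x1 x2 x3 : R) :
  2 <= h -> 4 <= n -> 0 < u -> 0 <= v ->
  T = 2 * (h + n) + 1 ->
  w = (2 * h + 6) * u + v ->
  x0 = 3 * (n - 1) * u + (2 * h + 3) * w ->
  x1 = n * (x0 - w) ->
  x2 = T * x1 - n * (2 * h + n + 1) * x0 ->
  x3 = T * x2 - (n - 1) * (2 * h + n + 2) * x1 ->
  h * (h + 2) ^+ 3 * (T * x0 - x1) * x1 ^+ 6 * x3 <
  (h + 1) ^+ 3 * (h + 3) * ((n + 1) * (2 * h + n)) * x0 ^+ 4 * x2 ^+ 4.
Proof.
move=> h_ge2 n_ge4 u_gt0 v_ge0 TE wE x0E x1E x2E x3E.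
have env_ge0 : all (>= 0) [:: h - 2; n - 4; u; v].
  by rewrite /= !subr_ge0 h_ge2 n_ge4 (ltW u_gt0) v_ge0.
have := expr_ge0 env_ge0 quartic_expr_coefs.
rewrite /eval_expr /quartic_expr /=.
rewrite [h - 2 + 2%:~R]subrK [n - 4 + 4%:~R]subrK.
(* The numerals of the evaluated expression are integer casts, equal to those
   of the hypotheses by computation only. *)
rewrite -[X in 2%:~R * (h + n) + X]/1 -TE -wE -x0E -x1E -x2E -x3E.
rewrite subr_ge0; apply: lt_le_trans.
by rewrite ltrDl exprn_gt0.
Qed.

(** * The three-term recurrence of the Boros-Moll numbers *)

Definition bm_weight (m k : nat) : rat :=
  2 ^+ k * 'C(2 * m - 2 * k, m - k)%:R * 'C(m + k, k)%:R.

Lemma central_binS n :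
  (n.+1 * 'C(2 * n.+1, n.+1) = 2 * (2 * n).+1 * 'C(2 * n, n))%N.
Proof.
have step1 : (n.+1 * 'C((2 * n).+2, n.+1) = (2 * n).+2 * 'C((2 * n).+1, n))%N.
  by rewrite -mul_bin_diag.
have step2 : (n.+1 * 'C((2 * n).+1, n) = (2 * n).+1 * 'C(2 * n, n))%N.
  rewrite (mul_bin_down (2 * n).+1) /=; congr (_ * _)%N.
  by rewrite subSn ?leq_pmull // mul2n -addnn addnK.
rewrite mulnS add2n step1 -mulnA -step2 mulnA; congr (_ * _)%N.
by rewrite mulnS.
Qed.

Lemma bm_weightS m k : (k < m)%N ->
  k.+1%:R * (2 * m%:R - 2 * k%:R - 1) * bm_weight m k.+1 =
  (m%:R - k%:R) * (m%:R + k%:R + 1) * bm_weight m k.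
Proof.
move=> lt_km; have [n ->] : exists n, m = (n.+1 + k)%N.
  by exists (m - k.+1)%N; rewrite addSnnS subnK.
rewrite /bm_weight.
have -> : (2 * (n.+1 + k) - 2 * k.+1 = 2 * n)%N by rewrite -mulnBr addSnnS addnK.
have -> : (2 * (n.+1 + k) - 2 * k = 2 * n.+1)%N by rewrite -mulnBr addnK.
have -> : (n.+1 + k - k.+1 = n)%N by rewrite addSnnS addnK.
have -> : (n.+1 + k - k = n.+1)%N by rewrite addnK.
have /(congr1 (fun x => x%:R : rat)) /= := central_binS n.
have /(congr1 (fun x => x%:R : rat)) /= := mul_bin_diag (n.+1 + k + k).+1 k.
rewrite -(addnS (n.+1 + k)) exprS.
move: 'C(_, k) 'C(_, k.+1) 'C(_, n) 'C(_, n.+1) => x y z t.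
rewrite natrM [in RHS]natrM => xy; rewrite natrM [in RHS]natrM => zt.
transitivity (2 ^+ k * ((2 * (2 * n).+1)%:R * z%:R) * (k.+1%:R * y%:R) : rat).
  by ring.
by rewrite -xy -zt; ring.
Qed.

(** The binomial coefficient ['C(k, i)] cuts off the terms [k < i] by itself;
    a summation range independent of [i] lets the sums for different [i] be
    combined term by term. *)
Lemma boros_moll_sum m i :
  boros_moll m i =
  2 ^- (2 * m) * \sum_(k < m.+1) bm_weight m k * 'C(k, i)%:R.
Proof.
rewrite /boros_moll; congr (_ * _).
rewrite -(big_mkord xpredT (fun k => bm_weight m k * 'C(k, i)%:R)).
have [le_im|lt_mi] := leqP i m.+1; last first.
  rewrite [LHS]big_geq ?(ltnW lt_mi) // big_nat big1 // => k /andP[_ lt_k].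
  by rewrite bin_small ?mulr0 // (ltn_trans lt_k lt_mi).
rewrite [RHS](big_cat_nat _ le_im) //=.
rewrite [X in _ = X + _]big_nat [X in _ = X + _]big1 ?add0r //.
by move=> k /andP[_ lt_k]; rewrite bin_small ?mulr0.
Qed.

Lemma mulr_bin_left (k j : nat) :
  j.+1%:R * 'C(k, j.+1)%:R = (k%:R - j%:R) * 'C(k, j)%:R :> rat.
Proof.
rewrite -natrM mul_bin_left natrM.
have [le_jk|lt_kj] := leqP j k; first by rewrite natrB.
by rewrite bin_small // !mulr0.
Qed.

(** The recurrence of the weights says that [P = \sum_k bm_weight m k * u ^ k]
    satisfies a differential equation in [u]; this is the coefficient of [x ^ j]
    of that equation after the substitution [u = x + 1]. *)
Lemma bm_weight_sum m j :
  \sum_(k < m.+1)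
    (m%:R - k%:R) * (m%:R + k%:R + 1) * bm_weight m k * 'C(k, j)%:R =
  \sum_(k < m.+1)
    (2 * m%:R - 2 * k%:R + 1) * bm_weight m k * (j.+1%:R * 'C(k, j.+1)%:R).
Proof.
rewrite big_ord_recr /= subrr !mul0r addr0.
rewrite [RHS]big_ord_recl /= bin0n /= !mulr0 add0r.
apply: eq_bigr => -[k /= lt_km] _.
rewrite -bm_weightS //= /bump /= add1n -[j.+1%:R * _]natrM -mul_bin_diag /= natrM.
by rewrite -[in 2 * k.+1%:R]natr1; ring.
Qed.

Lemma boros_moll_rec m j :
  j.+1%:R * j.+2%:R * boros_moll m j.+2 =
  (2 * m%:R + 1) * (j.+1%:R * boros_moll m j.+1)
  - (m%:R - j%:R) * (m%:R + j%:R + 1) * boros_moll m j.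
Proof.
rewrite !boros_moll_sum.
set S := fun i => \sum_(k < m.+1) bm_weight m k * 'C(k, i)%:R.
suff: j.+1%:R * j.+2%:R * S j.+2 = (2 * m%:R + 1) * (j.+1%:R * S j.+1)
   - (m%:R - j%:R) * (m%:R + j%:R + 1) * S j.
  rewrite -/(S _) -/(S j) -/(S j.+1) => E.
  by rewrite mulrCA E; ring.
(* Term by term the recurrence fails only by the difference of the summands of
   [bm_weight_sum]. *)
have pointwise k : j.+1%:R * j.+2%:R * 'C(k, j.+2)%:R =
    (2 * m%:R + 1) * (j.+1%:R * 'C(k, j.+1)%:R)
    - (m%:R - j%:R) * (m%:R + j%:R + 1) * 'C(k, j)%:R
    + ((m%:R - k%:R) * (m%:R + k%:R + 1) * 'C(k, j)%:R
       - (2 * m%:R - 2 * k%:R + 1) * (j.+1%:R * 'C(k, j.+1)%:R)) :> rat.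
  by rewrite -mulrA mulr_bin_left mulrCA mulr_bin_left -natr1; ring.
have /eqP := bm_weight_sum m j; rewrite -subr_eq0 => /eqP vanishing.
rewrite -[RHS]addr0 -vanishing /S !mulr_sumr -!sumrB -big_split /=.
by apply: eq_bigr => k _; rewrite mulrCA pointwise; ring.
Qed.

(** The [j]-th derivative at 0 of the polynomial with coefficients
    [boros_moll m j]. *)
Definition bm_deriv (m j : nat) : rat := j`!%:R * boros_moll m j.

Lemma bm_deriv_rec m j :
  bm_deriv m j.+2 =
  (2 * m%:R + 1) * bm_deriv m j.+1
  - (m%:R - j%:R) * (m%:R + j%:R + 1) * bm_deriv m j.
Proof.
transitivity (j`!%:R * (j.+1%:R * j.+2%:R * boros_moll m j.+2)).
  by rewrite /bm_deriv !factS !natrM; ring.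
by rewrite boros_moll_rec /bm_deriv factS natrM; ring.
Qed.

Lemma bm_deriv_gt0 m j : (j <= m)%N -> 0 < bm_deriv m j.
Proof.
move=> le_jm; rewrite mulr_gt0 ?ltr0n ?fact_gt0 // boros_moll_sum.
rewrite mulr_gt0 ?invr_gt0 ?exprn_gt0 // big_ord_recr /=.
rewrite ltr_wpDl ?sumr_ge0 // => [k _|].
  by rewrite !mulr_ge0 ?exprn_ge0.
by rewrite !mulr_gt0 ?exprn_gt0 ?ltr0n ?bin_gt0 ?leq_addl // subnn.
Qed.

Lemma bm_deriv_out m : bm_deriv m m.+1 = 0.
Proof. by rewrite /bm_deriv /boros_moll big_geq // !mulr0. Qed.

(** * Positivity of the continued fraction tails *)

(** The quotients [gap1/bm_deriv], [gap2/gap1], [gap3/gap2] are the first three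
    tails of the continued fraction of [bm_deriv m j.+1 / bm_deriv m j]. *)
Definition gap1 m j : rat := (m%:R - j%:R) * bm_deriv m j - bm_deriv m j.+1.
Definition gap2 m j : rat :=
  (m%:R - j%:R) * bm_deriv m j - (2 * j%:R + 3) * gap1 m j.
Definition gap3 m j : rat :=
  3 * (m%:R - j%:R - 1) * gap1 m j - (2 * j%:R + 6) * gap2 m j.

Lemma gap1_back m j :
  (m%:R + j%:R + 1) * gap1 m j = gap1 m j.+1 + bm_deriv m j.+1.
Proof. by rewrite /gap1 bm_deriv_rec -natr1; ring. Qed.

Lemma gap2_back m j :
  (m%:R + j%:R + 1) * gap2 m j = gap2 m j.+1 + 3 * gap1 m j.+1.
Proof.
rewrite /gap2 mulrBr [X in _ - X = _]mulrCA gap1_back.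
by rewrite /gap1 bm_deriv_rec -natr1; ring.
Qed.

Lemma gap3_back m j :
  (m%:R + j%:R + 1) * gap3 m j = gap3 m j.+1 + 5 * gap2 m j.+1.
Proof.
rewrite /gap3 mulrBr [X in X - _ = _]mulrCA [X in _ - X = _]mulrCA.
by rewrite gap1_back gap2_back /gap2 -natr1; ring.
Qed.

Lemma backward_ge0 m (f g : nat -> rat) c :
  0 <= c -> (forall j, (m%:R + j%:R + 1) * f j = f j.+1 + c * g j.+1) ->
  0 <= f m -> (forall j, (j <= m)%N -> 0 <= g j) ->
  forall j, (j <= m)%N -> 0 <= f j.
Proof.
move=> c_ge0 f_back fm_ge0 g_ge0 j le_jm; rewrite -(subKn le_jm).
elim: (m - j)%N (leq_subr j m) => [|n IH] lt_nm; first by rewrite subn0.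
have mj_gt0 : 0 < m%:R + (m - n.+1)%:R + 1 :> rat by rewrite -natrD natr1 ltr0n.
rewrite -(pmulr_rge0 _ mj_gt0) f_back -subSn // subSS.
by rewrite addr_ge0 ?mulr_ge0 ?IH ?g_ge0 ?leq_subr // ltnW.
Qed.

Lemma gap1_ge0 m j : (j <= m)%N -> 0 <= gap1 m j.
Proof.
apply: (@backward_ge0 m (gap1 m) (bm_deriv m) 1) => // [i||i le_im].
- by rewrite gap1_back mul1r.
- by rewrite /gap1 bm_deriv_out !(subrr, mul0r).
- exact/ltW/bm_deriv_gt0.
Qed.

Lemma gap2_ge0 m j : (j <= m)%N -> 0 <= gap2 m j.
Proof.
apply: (@backward_ge0 m (gap2 m) (gap1 m) 3) => // [i||i le_im].
- exact: gap2_back.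
- by rewrite /gap2 /gap1 bm_deriv_out !(subrr, mul0r, mulr0).
- exact: gap1_ge0.
Qed.

Lemma gap3_ge0 m j : (j <= m)%N -> 0 <= gap3 m j.
Proof.
apply: (@backward_ge0 m (gap3 m) (gap2 m) 5) => // [i||i le_im].
- exact: gap3_back.
- by rewrite /gap3 /gap2 /gap1 bm_deriv_out !(subrr, mul0r, mulr0).
- exact: gap2_ge0.
Qed.

Lemma gap1_gt0 m j : (j < m)%N -> 0 < gap1 m j.
Proof.
move=> lt_jm; have mj_gt0 : 0 < m%:R + j%:R + 1 :> rat by rewrite -natrD natr1 ltr0n.
by rewrite -(pmulr_rgt0 _ mj_gt0) gap1_back ltr_wpDl ?gap1_ge0 ?bm_deriv_gt0.
Qed.

Lemma gap2_gt0 m j : (j.+1 < m)%N -> 0 < gap2 m j.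
Proof.
move=> lt_jm; have mj_gt0 : 0 < m%:R + j%:R + 1 :> rat by rewrite -natrD natr1 ltr0n.
rewrite -(pmulr_rgt0 _ mj_gt0) gap2_back ltr_wpDl ?gap2_ge0 ?(ltnW lt_jm) //.
by rewrite mulr_gt0 ?gap1_gt0.
Qed.

(** * Strict log-concavity of the ratios *)

(** The inequality [d_(i-2) d_i^6 d_(i+2) < d_(i-1)^4 d_(i+1)^4] with [l = i-2];
    the polynomial factors in [l] come from the factorials in [bm_deriv]. *)
Lemma bm_deriv_quartic m l : (0 < l)%N -> (l + 5 <= m)%N ->
  l.+1%:R * (l.+1%:R + 2) ^+ 3 *
    bm_deriv m l * bm_deriv m l.+2 ^+ 6 * bm_deriv m l.+4 <
  (l.+1%:R + 1) ^+ 3 * (l.+1%:R + 3) *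
    bm_deriv m l.+1 ^+ 4 * bm_deriv m l.+3 ^+ 4.
Proof.
move=> l_gt0 le_lm; have [n def_m] : exists n, m = (l.+1 + n.+4)%N.
  by exists (m - (l + 5))%N; lia.
have n_ge : 4 <= n.+4%:R :> rat by rewrite ler_nat.
have h_ge : 2 <= l.+1%:R :> rat by rewrite ler_nat.
have m_split : m%:R = l.+1%:R + n.+4%:R :> rat by rewrite def_m natrD.
have u_gt0 : 0 < gap2 m l.+1 by apply: gap2_gt0; lia.
have v_ge0 : 0 <= gap3 m l.+1 by apply: gap3_ge0; lia.
(* The common denominator when [bm_deriv m l.+1] and [bm_deriv m l.+2] are
   expressed through [gap2 m l.+1] and [gap3 m l.+1]. *)
pose s := 3 * (n.+4%:R - 1) * n.+4%:R : rat.
have s_gt0 : 0 < s by rewrite /s !mulr_gt0 ?subr_gt0 ?ltr0n // ltr1n.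
have step0 : (n.+4%:R + 1) * (2 * l.+1%:R + n.+4%:R) * bm_deriv m l =
    (2 * m%:R + 1) * bm_deriv m l.+1 - bm_deriv m l.+2.
  by rewrite bm_deriv_rec m_split; ring.
have step2 : s * bm_deriv m l.+3 = (2 * m%:R + 1) * (s * bm_deriv m l.+2) -
    n.+4%:R * (2 * l.+1%:R + n.+4%:R + 1) * (s * bm_deriv m l.+1).
  by rewrite bm_deriv_rec m_split; ring.
have step3 : s * bm_deriv m l.+4 = (2 * m%:R + 1) * (s * bm_deriv m l.+3) -
    (n.+4%:R - 1) * (2 * l.+1%:R + n.+4%:R + 2) * (s * bm_deriv m l.+2).
  by rewrite bm_deriv_rec m_split; ring.
have wE : 3 * (n.+4%:R - 1) * gap1 m l.+1 =
    (2 * l.+1%:R + 6) * gap2 m l.+1 + gap3 m l.+1.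
  by rewrite /gap3 m_split; ring.
have x0E : s * bm_deriv m l.+1 = 3 * (n.+4%:R - 1) * gap2 m l.+1 +
    (2 * l.+1%:R + 3) * (3 * (n.+4%:R - 1) * gap1 m l.+1).
  by rewrite /gap2 m_split /s; ring.
have x1E : s * bm_deriv m l.+2 =
    n.+4%:R * (s * bm_deriv m l.+1 - 3 * (n.+4%:R - 1) * gap1 m l.+1).
  by rewrite /gap1 m_split /s; ring.
have TE : 2 * m%:R + 1 = 2 * (l.+1%:R + n.+4%:R) + 1 :> rat by rewrite m_split.
have := quartic_gap h_ge n_ge u_gt0 v_ge0 TE wE x0E x1E step2 step3.
have -> : (2 * m%:R + 1) * (s * bm_deriv m l.+1) - s * bm_deriv m l.+2 =
    s * ((n.+4%:R + 1) * (2 * l.+1%:R + n.+4%:R) * bm_deriv m l).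
  by rewrite step0; ring.
have c_gt0 : 0 < (n.+4%:R + 1) * (2 * l.+1%:R + n.+4%:R) * s ^+ 8.
  by rewrite natr1 -natrM -natrD -natrM mulr_gt0 ?ltr0n ?exprn_gt0.
move=> gap; rewrite -(ltr_pM2l c_gt0); move: gap.
by congr (_ < _); ring.
Qed.

Theorem theorem1p4 :
  exists M : nat, forall m : nat, (M <= m)%N ->
    forall i : nat, (3 <= i <= m - 3)%N ->
      boros_moll_ratio m i ^+ 2 >
      boros_moll_ratio m i.-1 * boros_moll_ratio m i.+1.
Proof.
exists 0%N => m _ [|[|h]] // /andP[le3i le_im].
have le_hm : (h + 5 <= m)%N by lia.
have h_gt0 : (0 < h)%N by lia.
have := bm_deriv_quartic h_gt0 le_hm; rewrite /bm_deriv /boros_moll_ratio /=.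
have d_gt0 j : (j <= m)%N -> 0 < boros_moll m j.
  move=> le_jm; rewrite -(pmulr_rgt0 _ (_ : 0 < j`!%:R)) ?ltr0n ?fact_gt0 //.
  exact: bm_deriv_gt0.
have [B_gt0 C_gt0 D_gt0] : [/\ 0 < boros_moll m h.+1, 0 < boros_moll m h.+2
    & 0 < boros_moll m h.+3].
  by split; apply: d_gt0; lia.
rewrite !factS !natrM.
move: (boros_moll m h) (boros_moll m h.+1) (boros_moll m h.+2)
  (boros_moll m h.+3) (boros_moll m h.+4) B_gt0 C_gt0 D_gt0.
move=> A B C D E B_gt0 C_gt0 D_gt0 gap.
have quartic : A * C ^+ 6 * E < B ^+ 4 * D ^+ 4.
  (* The factor shared by both sides of [gap] once the factorials are
     reduced to that of [h]. *)
  have c_gt0 : 0 < h`!%:R ^+ 8 * h.+1%:R ^+ 8 * h.+2%:R ^+ 7 *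
      h.+3%:R ^+ 4 * h.+4%:R :> rat.
    by rewrite !mulr_gt0 ?exprn_gt0 ?ltr0n ?fact_gt0.
  by rewrite -(ltr_pM2l c_gt0); move: gap; congr (_ < _); ring.
rewrite -subr_gt0.
have -> : (B * D / C ^+ 2) ^+ 2 - A * C / B ^+ 2 * (C * E / D ^+ 2) =
    (B ^+ 4 * D ^+ 4 - A * C ^+ 6 * E) / (B ^+ 2 * C ^+ 4 * D ^+ 2).
  by field; rewrite !lt0r_neq0.
by rewrite divr_gt0 ?subr_gt0 ?mulr_gt0 ?exprn_gt0.
Qed.
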